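(* Let $\mathcal A_1=\operatorname{Spec}(A_1)$ and $\mathcal A_2=\operatorname{Spec}(A_2)$ be cluster varieties, and let $(\Psi,\Phi,(R_t)_{t\in\Sigma(A_1)})$ be a cluster quasi-isomorphism from $\mathcal A_2$ to $\mathcal A_1$. Then $\Psi$ induces an isomorphism $\Psi:\mathcal D(\mathcal A_2)\to\mathcal D(\mathcal A_1)$ between the deep loci.
   Context: Cluster algebras are skew-symmetric of geometric type over $\mathbb{C}$: an extended exchange matrix is an $(n+m)\times n$ integer matrix $\tilde B=(b_{ij})$ with skew-symmetric top $n\times n$ block; a seed is $(\tilde{\mathbf x},\tilde B)$ with $\tilde{\mathbf x}=(x_1,\dots,x_{n+m})$ freely generating $\mathcal F=\mathbb{C}(x_1,\dots,x_{n+m})$; mutation at $k\le n$ performs matrix mutation and replaces $x_k$ by $x_k^{-1}\big(\prod_{b_{ik}>0}x_i^{b_{ik}}+\prod_{b_{ik}<0}x_i^{-b_{ik}}\big)$; $A$ is the $\mathbb{C}[x_{n+1}^{\pm1},\dots,x_{n+m}^{\pm1}]$-subalgebra generated by all cluster variables of the set $\Sigma(A)$ of seeds obtained by iterated mutation. $\mathcal A=\operatorname{Spec}A$; the cluster torus $T(t)$ of $t\in\Sigma(A)$ is the open locus where all variables of $t$ are nonzero; the deep locus is $\mathcal D(\mathcal A)=\mathcal A\setminus\bigcup_{t\in\Sigma(A)}T(t)$, a closed subset taken with its reduced structure. Quasi-morphisms. Let $\mathcal A_1,\mathcal A_2$ have the same number $n$ of mutable and $m$ of frozen variables. A cluster quasi-morphism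 from $\mathcal A_2$ to $\mathcal A_1$ is a triple $(\Psi,\Phi,(R_t)_{t\in\Sigma(A_1)})$ where $\Psi:\mathcal A_2\to\mathcal A_1$ is a morphism of varieties with dual $\Psi^*:A_1\to A_2$; $\Phi:\Sigma(A_1)\to\Sigma(A_2)$ is a map commuting with mutation; and for each $t$, $R_t$ is an $(n+m)\times(n+m)$ integer matrix of the form $\begin{pmatrix}I_n&0\\P_t&Q_t\end{pmatrix}$ such that, writing $t=(\mathbf z,\tilde B_1)$ and $\Phi(t)=(\mathbf x,\tilde B_2)$, one has $\tilde B_2=R_t\tilde B_1$ and $\Psi^*(z_j)=\prod_{i=1}^{n+m}x_i^{(R_t)_{ij}}$. It is a cluster quasi-isomorphism if $\Psi$ is an isomorphism of varieties (equivalently $R_t\in\mathrm{GL}(n+m,\mathbb{Z})$ for some $t$). *)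

(* Defs.v *)
From HB Require Import structures.
From mathcomp Require Import all_boot all_order all_algebra.
From mathcomp Require Import generic_quotient fraction.
From mathcomp Require Import boolp classical_sets.
From mathcomp Require Import mpoly.

Set Implicit Arguments.
Unset Strict Implicit.
Unset Printing Implicit Defensive.

Import Order.TTheory GRing.Theory Num.Theory.

Local Open Scope ring_scope.

(* An affine [K]-scheme is given by its coordinate ring.  The zero ring must be
   allowed (the deep locus may be empty), which rules out [comAlgType K]:
   a [K]-algebra is a [comPzRingType] with a structure morphism from [K]. *)

Record calg (K : fieldType) := CAlg {
  ca_ring :> comPzRingType;
  ca_scal : {rmorphism K -> ca_ring}
}.

Definition prime_ideal (A : comPzRingType) (I : set A) : Prop :=
  [/\ I 0,
      forall a b, I a -> I b -> I (a + b),
      forall a b, I b -> I (a * b),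
      ~ I 1
    & forall a b, I (a * b) -> I a \/ I b].

Record spec (K : fieldType) (A : calg K) := SpecPoint {
  pt_ideal :> A -> Prop;
  pt_prime : prime_ideal pt_ideal
}.

Definition zariski_closed (K : fieldType) (A : calg K) (Z : set (spec A)) :=
  exists S : set A, Z = [set p : spec A | (S `<=` pt_ideal p)%classic]%classic.

(* Morphisms [Spec A -> Spec B], carried by their dual [B -> A]. *)
Record morph (K : fieldType) (A B : calg K) := Morph {
  dual : {rmorphism B -> A};
  dual_scal : forall c : K, dual (ca_scal B c) = ca_scal A c
}.

Definition morph_eq (K : fieldType) (A B : calg K) (f g : morph A B) : Prop :=
  dual f =1 dual g.

Section Morphisms.
Variables (K : fieldType) (A B D : calg K).

Definition morph_id : morph A A := @Morph K A A idfun (fun=> erefl).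

Fact morph_comp_scal (g : morph B D) (f : morph A B) (c : K) :
  (dual f \o dual g) (ca_scal D c) = ca_scal A c.
Proof. by rewrite /= !dual_scal. Qed.

Definition morph_comp (g : morph B D) (f : morph A B) : morph A D :=
  @Morph K A D (dual f \o dual g) (morph_comp_scal g f).

Fact spec_map_prime (f : morph A B) (p : spec A) :
  prime_ideal (dual f @^-1` pt_ideal p)%classic.
Proof.
case: (pt_prime p) => p0 pD pM p1 pP; split => /=.
- by rewrite rmorph0.
- by move=> a b ? ?; rewrite rmorphD; exact: pD.
- by move=> a b ?; rewrite rmorphM; exact: pM.
- by rewrite rmorph1.
- by move=> a b; rewrite rmorphM => /pP.
Qed.

Definition spec_map (f : morph A B) (p : spec A) : spec B :=
  SpecPoint (spec_map_prime f p).

End Morphisms.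

Arguments morph_id {K} A.

Definition is_iso (K : fieldType) (A B : calg K) (f : morph A B) : Prop :=
  exists g : morph B A,
    morph_eq (morph_comp g f) (morph_id A) /\
    morph_eq (morph_comp f g) (morph_id B).

(* The reduced structure on a closed [Z] is [Spec (A / I(Z))], where [I(Z)], the
   ideal of functions vanishing on [Z], is the intersection of the primes in
   [Z]; its underlying set is [Z] by [range_reduced_incl]. *)

Section Reduced.
Variables (K : fieldType) (A : calg K) (Z : set (spec A)).

Definition vanishing_ideal : set A := [set a | forall p, Z p -> p a]%classic.

Fact vanishing0 : vanishing_ideal 0.
Proof. by move=> p _; case: (pt_prime p). Qed.

Fact vanishingD a b :
  vanishing_ideal a -> vanishing_ideal b -> vanishing_ideal (a + b).
Proof.
by move=> Ia Ib p Zp; case: (pt_prime p) => _ pD _ _ _;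
  apply: pD; [exact: Ia | exact: Ib].
Qed.

Fact vanishingM a b : vanishing_ideal b -> vanishing_ideal (a * b).
Proof. by move=> Ib p Zp; case: (pt_prime p) => _ _ pM _ _; exact/pM/Ib. Qed.

Fact vanishingN a : vanishing_ideal a -> vanishing_ideal (- a).
Proof. by rewrite -mulN1r; exact: vanishingM. Qed.

Definition vanishing_rel : rel A := fun a b => `[< vanishing_ideal (a - b) >].

Fact vanishing_equiv : equiv_class_of vanishing_rel.
Proof.
have sym a b : vanishing_rel a b -> vanishing_rel b a.
  by move=> /asboolP /vanishingN; rewrite opprB => ?; exact/asboolP.
split.
- by move=> a; apply/asboolP; rewrite subrr; exact: vanishing0.
- by move=> a b; apply/idP/idP; exact: sym.
- move=> b a c /asboolP ab /asboolP bc; apply/asboolP.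
  by rewrite -(subrK b a) -addrA; exact: vanishingD.
Qed.

Canonical vanishing_equiv_rel := EquivRelPack vanishing_equiv.

Definition reduced_ring := {eq_quot vanishing_equiv_rel}%qT.
HB.instance Definition _ := Choice.on reduced_ring.
HB.instance Definition _ := EqQuotient.on reduced_ring.

Definition rproj (a : A) : reduced_ring := (\pi a)%qT.
Definition rlift (x : reduced_ring) : A := repr x.

Fact rproj_eqP a b : rproj a = rproj b <-> vanishing_ideal (a - b).
Proof.
rewrite /rproj; split.
- by move/eqquotP => /asboolP.
- by move=> h; apply/eqquotP/asboolP.
Qed.

Fact rliftK x : rproj (rlift x) = x.
Proof. exact: reprK. Qed.

Definition radd x y := rproj (rlift x + rlift y).
Definition ropp x := rproj (- rlift x).
Definition rmul x y := rproj (rlift x * rlift y).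

Fact rlift_rproj a : vanishing_ideal (rlift (rproj a) - a).
Proof. by apply/rproj_eqP; rewrite rliftK. Qed.

Fact rprojD a b : rproj (a + b) = radd (rproj a) (rproj b).
Proof.
apply/esym/rproj_eqP; rewrite opprD addrACA.
by apply: vanishingD; exact: rlift_rproj.
Qed.

Fact rprojN a : rproj (- a) = ropp (rproj a).
Proof.
by apply/esym/rproj_eqP; rewrite -opprD; apply/vanishingN/rlift_rproj.
Qed.

Fact rprojM a b : rproj (a * b) = rmul (rproj a) (rproj b).
Proof.
apply/esym/rproj_eqP; set a' := rlift _; set b' := rlift _.
have -> : a' * b' - a * b = b' * (a' - a) + a * (b' - b).
  by rewrite !mulrBr [b' * a']mulrC [b' * a]mulrC addrA subrK.
by apply: vanishingD; apply: vanishingM; exact: rlift_rproj.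
Qed.

Fact raddA : associative radd.
Proof.
by move=> x y z; rewrite -(rliftK x) -(rliftK y) -(rliftK z) -!rprojD addrA.
Qed.
Fact raddC : commutative radd.
Proof. by move=> x y; rewrite -(rliftK x) -(rliftK y) -!rprojD addrC. Qed.
Fact radd0 : left_id (rproj 0) radd.
Proof. by move=> x; rewrite -(rliftK x) -rprojD add0r. Qed.
Fact raddN : left_inverse (rproj 0) ropp radd.
Proof. by move=> x; rewrite -(rliftK x) -rprojN -rprojD addNr. Qed.

HB.instance Definition _ :=
  GRing.isZmodule.Build reduced_ring raddA raddC radd0 raddN.

Fact rmulA : associative rmul.
Proof.
by move=> x y z; rewrite -(rliftK x) -(rliftK y) -(rliftK z) -!rprojM mulrA.
Qed.
Fact rmulC : commutative rmul.
Proof. by move=> x y; rewrite -(rliftK x) -(rliftK y) -!rprojM mulrC. Qed.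
Fact rmul1 : left_id (rproj 1) rmul.
Proof. by move=> x; rewrite -(rliftK x) -rprojM mul1r. Qed.
Fact rmulDl : left_distributive rmul (+%R : reduced_ring -> _ -> _).
Proof.
move=> x y z; rewrite -(rliftK x) -(rliftK y) -(rliftK z).
by rewrite -[rproj _ + _]rprojD -!rprojM -[RHS]rprojD mulrDl.
Qed.

HB.instance Definition _ :=
  GRing.Zmodule_isComPzRing.Build reduced_ring rmulA rmulC rmul1 rmulDl.

Fact rproj_zmod_morphism : zmod_morphism rproj.
Proof. by move=> a b; rewrite rprojD rprojN. Qed.
HB.instance Definition _ :=
  GRing.isZmodMorphism.Build A reduced_ring rproj rproj_zmod_morphism.

Fact rproj_monoid_morphism : monoid_morphism rproj.
Proof. by split => // a b; rewrite rprojM. Qed.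
HB.instance Definition _ :=
  GRing.isMonoidMorphism.Build A reduced_ring rproj rproj_monoid_morphism.

Definition reduced : calg K :=
  @CAlg K reduced_ring (rproj \o ca_scal A : {rmorphism K -> reduced_ring}).

(* The closed immersion [Spec (A / I(Z)) -> Spec A]. *)
Definition reduced_incl : morph reduced A :=
  @Morph K reduced A (rproj : {rmorphism A -> reduced_ring}) (fun=> erefl).

Lemma range_reduced_incl :
  zariski_closed Z -> range (spec_map reduced_incl) = Z.
Proof.
have ptE (B : calg K) (p q : spec B) : pt_ideal p = pt_ideal q -> p = q.
  case: p q => [p pp] [q qp] /= e; case: _ / e in qp *.
  by rewrite (Prop_irrelevance pp qp).
move=> [S ZS]; apply/seteqP; split.
  move=> _ [q _ <-]; rewrite ZS => a Sa /=.
  rewrite (_ : rproj a = 0); first by case: (pt_prime q).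
  by apply/rproj_eqP; rewrite subr0 => p; rewrite ZS; exact.
move=> p Zp; pose q : set reduced := [set x | p (rlift x)]%classic.
have qE a : q (rproj a) <-> p a.
  have := @rlift_rproj a p Zp; case: (pt_prime p) => _ pD pM _ _ pa.
  split=> h; last by rewrite /q/= -(subrK a (rlift _)); exact: pD.
  rewrite -(subKr (rlift (rproj a)) a) addrC; apply: pD => //.
  by rewrite -mulN1r; exact: pM.
have qP : prime_ideal q.
  case: (pt_prime p) => p0 pD pM p1 pP; split.
  - exact/(qE 0).
  - by move=> x y; rewrite -(rliftK x) -(rliftK y) -rmorphD !qE; exact: pD.
  - by move=> x y; rewrite -(rliftK x) -(rliftK y) -rmorphM !qE; exact: pM.
  - by move/(qE 1).
  - by move=> x y; rewrite -(rliftK x) -(rliftK y) -rmorphM !qE; exact: pP.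
exists (SpecPoint qP) => //; apply: ptE.
by apply/seteqP; split=> a /qE.
Qed.

End Reduced.

(* [f : Spec A -> Spec B] maps [Z] onto [W] and restricts to an isomorphism
   between the reduced closed subschemes supported on [Z] and [W]. *)
Definition induces_iso (K : fieldType) (A B : calg K) (f : morph A B)
    (Z : set (spec A)) (W : set (spec B)) : Prop :=
  (spec_map f @` Z)%classic = W /\
  exists g : morph (reduced Z) (reduced W),
    is_iso g /\
    morph_eq (morph_comp (reduced_incl W) g) (morph_comp f (reduced_incl Z)).

(* Among the indices in ['I_(n + m)], the [lshift m k] are mutable and the
   [rshift n j] are frozen.  Seeds are labelled. *)

Notation ratfun K k := {fraction {mpoly K[k]}}.

Definition ratfun_scal (K : fieldType) (k : nat) : {rmorphism K -> ratfun K k} :=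
  (@tofrac {mpoly K[k]} \o @mpolyC k K : {rmorphism K -> ratfun K k}).

Record seed (K : fieldType) (n m : nat) := Seed {
  svar : {ffun 'I_(n + m) -> ratfun K (n + m)};
  smat : 'M[int]_(n + m, n)
}.

(* [x] is algebraically independent over [K] and generates the field
   [K(x_1, .., x_k)]. *)
Definition freely_generates (K : fieldType) (k : nat)
    (x : {ffun 'I_k -> ratfun K k}) : Prop :=
  let ev (p : {mpoly K[k]}) := mmap (@ratfun_scal K k) x p in
  (forall p, ev p = 0 -> p = 0) /\
  (forall f, exists p q, ev q != 0 /\ f = ev p / ev q).

Definition is_seed (K : fieldType) (n m : nat) (t : seed K n m) : Prop :=
  freely_generates (svar t) /\ (usubmx (smat t))^T = - usubmx (smat t).

Definition mutate_mat (n m : nat) (k : 'I_n) (B : 'M[int]_(n + m, n)) :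
    'M[int]_(n + m, n) :=
  \matrix_(i, j)
    if (i == lshift m k) || (j == k) then - B i j
    else B i j + Num.max (B i k) 0 * Num.max (B (lshift m k) j) 0
               - Num.max (- B i k) 0 * Num.max (- B (lshift m k) j) 0.

Definition mutate (K : fieldType) (n m : nat) (k : 'I_n) (t : seed K n m) :
    seed K n m :=
  let x := svar t in
  let B := smat t in
  Seed
    [ffun i => if i == lshift m k then
                 (x i)^-1 * (\prod_(j | 0 < B j k) x j ^ B j k
                             + \prod_(j | B j k < 0) x j ^ (- B j k))
               else x i]
    (mutate_mat k B).

Inductive reachable (K : fieldType) (n m : nat) (t0 : seed K n m) :
    seed K n m -> Prop :=
| reachable_refl : reachable t0 t0
| reachable_mutate k t : reachable t0 t -> reachable t0 (mutate k t).

(* $\Sigma(A)$ for the cluster algebra [A] with initial seed [t0]. *)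
Record seeds (K : fieldType) (n m : nat) (t0 : seed K n m) := SeedIn {
  seed_of :> seed K n m;
  seed_reachable : reachable t0 seed_of
}.

Definition mutate_in (K : fieldType) (n m : nat) (t0 : seed K n m) (k : 'I_n)
    (t : seeds t0) : seeds t0 :=
  SeedIn (reachable_mutate k (seed_reachable t)).

(* The subalgebra of [ratfun K (n + m)] over the Laurent ring in the frozen
   variables, which mutation leaves unchanged, generated by the cluster
   variables. *)
Inductive in_cluster_algebra (K : fieldType) (n m : nat) (t0 : seed K n m) :
    ratfun K (n + m) -> Prop :=
| ica_scal c : in_cluster_algebra t0 (ratfun_scal K (n + m) c)
| ica_frozen j : in_cluster_algebra t0 (svar t0 (rshift n j))
| ica_frozenV j : in_cluster_algebra t0 (svar t0 (rshift n j))^-1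
| ica_cluster (t : seeds t0) k : in_cluster_algebra t0 (svar t (lshift m k))
| ica_add a b : in_cluster_algebra t0 a -> in_cluster_algebra t0 b ->
    in_cluster_algebra t0 (a + b)
| ica_mul a b : in_cluster_algebra t0 a -> in_cluster_algebra t0 b ->
    in_cluster_algebra t0 (a * b).

Section ClusterAlgebra.
Variables (K : fieldType) (n m : nat) (t0 : seed K n m).

Definition cluster_pred : pred (ratfun K (n + m)) :=
  fun a => `[< in_cluster_algebra t0 a >].

Fact cluster_pred_subring : subring_closed cluster_pred.
Proof.
have scal c : ratfun_scal K (n + m) c \in cluster_pred.
  by apply/asboolP; exact: ica_scal.
split.
- by rewrite -(rmorph1 (ratfun_scal K (n + m))).
- move=> a b /asboolP Aa /asboolP Ab; apply/asboolP.
  apply: ica_add => //; rewrite -mulN1r; apply: ica_mul => //.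
  by rewrite -(rmorphN1 (ratfun_scal K (n + m))); exact: ica_scal.
- by move=> a b /asboolP Aa /asboolP Ab; apply/asboolP; exact: ica_mul.
Qed.

HB.instance Definition _ :=
  GRing.isSubringClosed.Build (ratfun K (n + m)) cluster_pred
    cluster_pred_subring.

Definition cluster_ring := {a | cluster_pred a}.
HB.instance Definition _ := SubChoice.on cluster_ring.
HB.instance Definition _ := [SubChoice_isSubComNzRing of cluster_ring by <:].

Definition cluster_scal (c : K) : cluster_ring :=
  Sub (ratfun_scal K (n + m) c) (asboolT (ica_scal t0 c)).

Fact cluster_scal_zmod_morphism : zmod_morphism cluster_scal.
Proof.
by move=> a b; apply/val_inj; exact: (rmorphB (ratfun_scal K (n + m))).
Qed.
HB.instance Definition _ :=
  GRing.isZmodMorphism.Build K cluster_ring cluster_scal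
    cluster_scal_zmod_morphism.

Fact cluster_scal_monoid_morphism : monoid_morphism cluster_scal.
Proof.
split=> [|a b]; apply/val_inj.
- exact: (rmorph1 (ratfun_scal K (n + m))).
- exact: (rmorphM (ratfun_scal K (n + m))).
Qed.
HB.instance Definition _ :=
  GRing.isMonoidMorphism.Build K cluster_ring cluster_scal
    cluster_scal_monoid_morphism.

Definition cluster_algebra : calg K :=
  @CAlg K cluster_ring (cluster_scal : {rmorphism K -> cluster_ring}).

Fact svar_in_cluster_algebra (t : seeds t0) i :
  in_cluster_algebra t0 (svar t i).
Proof.
case: (split_ordP i) => [k ->|j ->]; first exact: ica_cluster.
suff -> : svar t (rshift n j) = svar t0 (rshift n j) by exact: ica_frozen.
case: t => t /=; elim=> // k {}t _ IH; rewrite ffunE ifN //.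
by rewrite eq_rlshift.
Qed.

Definition cvar (t : seeds t0) (i : 'I_(n + m)) : cluster_algebra :=
  Sub (svar t i) (asboolT (svar_in_cluster_algebra t i)) : cluster_ring.

Definition cluster_torus (t : seeds t0) : set (spec cluster_algebra) :=
  [set p : spec cluster_algebra | forall i, ~ p (cvar t i)]%classic.

Definition deep_locus : set (spec cluster_algebra) :=
  (~` \bigcup_(t in [set: seeds t0]) cluster_torus t)%classic.

Lemma deep_locus_closed : zariski_closed deep_locus.
Proof.
exists [set \prod_i cvar t i | t in [set: seeds t0]]%classic.
apply/seteqP; split=> p.
- move=> Dp _ [t _ <-]; apply: contrapT => h; apply: Dp; exists t => // i pi.
  apply: h; rewrite (bigD1 i) //= mulrC.
  by case: (pt_prime p) => _ _ pM _ _; exact: pM.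
- move=> Sp [t _ Tp]; have /Sp : [set \prod_i cvar t i |
    t in [set: seeds t0]]%classic (\prod_i cvar t i) by exists t.
  case: (pt_prime p) => _ _ _ p1 pP; apply: (big_ind (fun a => ~ p a)) => //.
  by move=> a b pa pb /pP[].
Qed.

End ClusterAlgebra.

Arguments deep_locus {K n m} t0.

Section QuasiMorphisms.
Variables (K : fieldType) (n m : nat).

(* A cluster quasi-morphism from [Spec A2] to [Spec A1], where [Ai] is the
   cluster algebra with initial seed [ti]. *)
Record quasi_morphism (t2 t1 : seed K n m) := QuasiMorphism {
  qm_Psi : morph (cluster_algebra t2) (cluster_algebra t1);
  qm_Phi : seeds t1 -> seeds t2;
  qm_R : seeds t1 -> 'M[int]_(n + m);
  qm_Phi_mutate : forall (k : 'I_n) (t : seeds t1),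
    qm_Phi (mutate_in k t) = mutate_in k (qm_Phi t);
  qm_R_shape : forall t : seeds t1, exists (P : 'M[int]_(m, n)) (Q : 'M[int]_m),
    qm_R t = block_mx 1%:M 0 P Q;
  qm_smat : forall t : seeds t1, smat (qm_Phi t) = qm_R t *m smat t;
  qm_svar : forall (t : seeds t1) (j : 'I_(n + m)),
    \val (dual qm_Psi (cvar t j) : cluster_ring t2) =
      \prod_i svar (qm_Phi t) i ^ qm_R t i j
}.

Definition quasi_isomorphism (t2 t1 : seed K n m) (f : quasi_morphism t2 t1) :=
  is_iso (qm_Psi f).

End QuasiMorphisms.

(* Main.v *)
Require Import Defs.
From HB Require Import structures.
From mathcomp Require Import all_boot all_algebra.
From mathcomp Require Import classical_sets reals complex.
From mathcomp Require Import all_order boolp mpoly ring.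

(** The frozen variables are units of a cluster algebra, so no prime contains
    them, and [Psi^*] maps the mutable variables of [t] to those of [Phi t] up
    to units; hence [T(Phi t)] is the preimage of [T(t)].  Since [Phi] commutes
    with mutation and mutation is an involution, every seed of the second
    algebra lies in the image of [Phi], so the deep locus of [A2] is the
    preimage of that of [A1], and an isomorphism restricts to preimages.
    Mutation is involutive as soon as no exchange polynomial vanishes; this
    holds because all cluster variables are subtraction-free expressions in the
    initial ones, hence positive when these are specialized to [1]. *)

Set Implicit Arguments.
Unset Strict Implicit.
Unset Printing Implicit Defensive.

Import Order.TTheory GRing.Theory Num.Theory.

(** * Restricting isomorphisms of affine schemes to reduced closed subschemes *)

Section Restriction.
Local Open Scope ring_scope.
Variable K : fieldType.

Lemma spec_eq (A : calg K) (p q : spec A) : p =1 q -> p = q.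
Proof.
case: p q => [p pp] [q qp] /= /funext pq; case: _ / pq in qp *.
by rewrite (Prop_irrelevance pp qp).
Qed.

Lemma prime_idealMu (A : comPzRingType) (I : set A) (a u v : A) :
  prime_ideal I -> u * v = 1 -> I (a * u) <-> I a.
Proof.
move=> [_ _ IM _ _] uv; split=> Ia; last by rewrite mulrC; apply: IM.
by rewrite -(mulr1 a) -uv mulrA mulrC; apply: IM.
Qed.

Lemma prime_ideal_unit (A : comPzRingType) (I : set A) (u v : A) :
  prime_ideal I -> u * v = 1 -> ~ I u.
Proof.
by move=> [_ _ IM I1 _] uv Iu; apply: I1; rewrite -uv mulrC; apply: IM.
Qed.

Section ReducedMap.
Variables (A B : calg K) (Z : set (spec A)) (W : set (spec B)).
Variables (f : morph A B) (ZW : forall p, Z p -> W (spec_map f p)).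

Definition reduced_dual (x : reduced_ring W) : reduced_ring Z :=
  rproj Z (dual f (rlift x)).

(** Functions vanishing on [W] pull back along [f] to functions vanishing on [Z], so the choice of
    representative made by [rlift] is immaterial. *)
Lemma reduced_dualE b : reduced_dual (rproj W b) = rproj Z (dual f b).
Proof.
apply/rproj_eqP => p Zp; rewrite -rmorphB.
by have := rlift_rproj (Z := W) b (ZW Zp).
Qed.

Fact reduced_dual_zmod_morphism : zmod_morphism reduced_dual.
Proof.
move=> x y; rewrite -(rliftK x) -(rliftK y) -rmorphB !reduced_dualE.
by rewrite !rmorphB.
Qed.

Fact reduced_dual_monoid_morphism : monoid_morphism reduced_dual.
Proof.
split=> [|x y]; first by rewrite -(rmorph1 (rproj W)) reduced_dualE !rmorph1.
rewrite -(rliftK x) -(rliftK y) -rmorphM !reduced_dualE.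
by rewrite !rmorphM.
Qed.

HB.instance Definition _ := GRing.isZmodMorphism.Build
  (reduced_ring W) (reduced_ring Z) reduced_dual reduced_dual_zmod_morphism.
HB.instance Definition _ := GRing.isMonoidMorphism.Build
  (reduced_ring W) (reduced_ring Z) reduced_dual reduced_dual_monoid_morphism.

Fact reduced_dual_scal (c : K) :
  reduced_dual (ca_scal (reduced W) c) = ca_scal (reduced Z) c.
Proof. by rewrite /= reduced_dualE dual_scal. Qed.

Definition reduced_map : morph (reduced Z) (reduced W) :=
  @Morph K (reduced Z) (reduced W)
    (reduced_dual : {rmorphism reduced_ring W -> reduced_ring Z})
    reduced_dual_scal.

End ReducedMap.

(** As [Z] is the full preimage of [W], the inverse of [f] also maps [W] into [Z]. Both morphisms
    therefore descend to the reduced quotients, where they remain mutually inverse. *)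
Lemma iso_induces_iso (A B : calg K) (f : morph A B)
    (Z : set (spec A)) (W : set (spec B)) :
  is_iso f -> (forall p, Z p <-> W (spec_map f p)) -> induces_iso f Z W.
Proof.
move=> [g [gf fg]] ZW.
have fgK q : spec_map f (spec_map g q) = q.
  by apply: spec_eq => b; exact: (congr1 (pt_ideal q) (fg b)).
have Zf p : Z p -> W (spec_map f p) by move/ZW.
have Wg q : W q -> Z (spec_map g q) by move=> Wq; apply/ZW; rewrite fgK.
split.
  apply/seteqP; split=> [_ [p /ZW Wp <-] //|q Wq].
  by exists (spec_map g q); [exact: Wg | exact: fgK].
exists (reduced_map Zf); split; last by move=> b /=; exact: reduced_dualE.
exists (reduced_map Wg); split=> x /=.
- rewrite -[x in LHS]rliftK (reduced_dualE Wg) (reduced_dualE Zf).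
  by rewrite (congr1 (rproj Z) (gf (rlift x))) rliftK.
- rewrite -[x in LHS]rliftK (reduced_dualE Zf) (reduced_dualE Wg).
  by rewrite (congr1 (rproj W) (fg (rlift x))) rliftK.
Qed.

End Restriction.

(** * Seed mutation is an involution on the seeds reachable from an initial seed *)

Section MutationInvolution.
Local Open Scope ring_scope.
Variables (K : numFieldType) (n m : nat).
Implicit Types (s t : seed K n m) (B : 'M[int]_(n + m, n)).

Lemma invf_mulVK (F : fieldType) (a b : F) : b != 0 -> (a^-1 * b)^-1 * b = a.
Proof. by move=> b0; rewrite invfM invrK mulfVK. Qed.

(** Row and column [k] change sign, which swaps the two correction products, so the second
    correction cancels the first. *)
Lemma mutate_matK (k : 'I_n) : involutive (@mutate_mat n m k).
Proof.
move=> B; apply/matrixP=> i j; rewrite !mxE !eqxx /= !orbT.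
case: ifP => ijk; rewrite ijk; first by rewrite opprK.
by rewrite !opprK; ring.
Qed.

(** Transposing [i] and [j] swaps the two correction products up to skew-symmetry, hence negates
    their difference. *)
Lemma mutate_mat_skew (k : 'I_n) B :
  (usubmx B)^T = - usubmx B ->
  (usubmx (mutate_mat k B))^T = - usubmx (mutate_mat k B).
Proof.
move=> skew; apply/matrixP=> i j.
have e (a b : 'I_n) : B (lshift m b) a = - B (lshift m a) b.
  by have /matrixP/(_ a b) := skew; rewrite !mxE.
rewrite !mxE !(inj_eq (@lshift_inj _ _)) orbC.
case: ifP => _; first by rewrite e.
by rewrite (e i j) (e i k) (e k j) !opprK; ring.
Qed.

(* Values of subtraction-free expressions in the [x i]; positivity of [p] and
   [q] at [(1, .., 1)] replaces positivity of their coefficients. *)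
Definition pos_ratio (x : {ffun 'I_(n + m) -> ratfun K (n + m)})
    (a : ratfun K (n + m)) : Prop :=
  exists p q : {mpoly K[n + m]},
    [/\ 0 < p.@[fun=> 1], 0 < q.@[fun=> 1]
      & a = mmap (@ratfun_scal K (n + m)) x p
            / mmap (@ratfun_scal K (n + m)) x q].

Section PosRatio.
Variable x : {ffun 'I_(n + m) -> ratfun K (n + m)}.
Hypothesis free_x : freely_generates x.
Local Notation ev := (mmap (@ratfun_scal K (n + m)) x).

(** Freeness makes [ev] injective, and a polynomial with a positive value is nonzero. Over the
    complex numbers the order is partial, with [0 < z] meaning that [z] is real and positive. *)
Lemma ev_neq0 (p : {mpoly K[n + m]}) : 0 < p.@[fun=> 1] -> ev p != 0.
Proof.
by move=> p_gt0; apply/eqP=> /(free_x.1) p0; rewrite p0 meval0 ltxx in p_gt0.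
Qed.

Lemma pos_ratio_neq0 a : pos_ratio x a -> a != 0.
Proof.
by move=> [p [q [p0 q0 ->]]]; rewrite mulf_neq0 ?invr_neq0 ?ev_neq0.
Qed.

Lemma pos_ratio_var i : pos_ratio x (x i).
Proof.
exists 'X_i, 1; split; rewrite ?mevalXU ?meval1 ?ltr01 //.
by rewrite mmapX mmap1U rmorph1 divr1.
Qed.

Lemma pos_ratio1 : pos_ratio x 1.
Proof. by exists 1, 1; rewrite meval1 ltr01 rmorph1 divr1. Qed.

Lemma pos_ratioD a b : pos_ratio x a -> pos_ratio x b -> pos_ratio x (a + b).
Proof.
move=> [p [q [p0 q0 ->]]] [p' [q' [p0' q0' ->]]].
exists (p * q' + p' * q), (q * q'); split.
- by rewrite mevalD !mevalM addr_gt0 ?mulr_gt0.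
- by rewrite mevalM mulr_gt0.
- by rewrite rmorphD !rmorphM addf_div ?ev_neq0.
Qed.

Lemma pos_ratioM a b : pos_ratio x a -> pos_ratio x b -> pos_ratio x (a * b).
Proof.
move=> [p [q [p0 q0 ->]]] [p' [q' [p0' q0' ->]]].
exists (p * p'), (q * q'); split; rewrite ?mevalM ?mulr_gt0 //.
by rewrite !rmorphM mulf_div.
Qed.

Lemma pos_ratioV a : pos_ratio x a -> pos_ratio x a^-1.
Proof. by move=> [p [q [p0 q0 ->]]]; exists q, p; rewrite invf_div. Qed.

Lemma pos_ratioXz a (z : int) : pos_ratio x a -> pos_ratio x (a ^ z).
Proof.
move=> xa; have xaX k : pos_ratio x (a ^+ k).
  by elim: k => [|k IH]; [exact: pos_ratio1 | rewrite exprS; exact: pos_ratioM].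
by case: z => k; [exact: xaX | exact/pos_ratioV/xaX].
Qed.

(** The invariant carried along mutations: [x] stays the initial cluster while [t] varies. *)
Definition exchange_regular t :=
  (forall i, pos_ratio x (svar t i)) /\
  (usubmx (smat t))^T = - usubmx (smat t).

Lemma pos_ratio_exchange t (k : 'I_n) : exchange_regular t ->
  pos_ratio x (\prod_(j | 0 < smat t j k) svar t j ^ smat t j k
               + \prod_(j | smat t j k < 0) svar t j ^ (- smat t j k)).
Proof.
move=> [tx _]; apply: pos_ratioD;
  (apply: big_ind; [exact: pos_ratio1 | exact: pos_ratioM |]) => j _;
  exact: pos_ratioXz.
Qed.

Lemma exchange_regular_mutate t (k : 'I_n) :
  exchange_regular t -> exchange_regular (mutate k t).
Proof.
move=> tx; split; last exact: mutate_mat_skew tx.2.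
move=> i; rewrite ffunE; case: ifP => _; last exact: tx.1.
by apply: pos_ratioM; [exact/pos_ratioV/tx.1 | exact: pos_ratio_exchange].
Qed.

(** Both mutations use the same exchange polynomial [P], and inverting [P / x_k] and multiplying by
    [P] gives back [x_k] because [P] is nonzero. *)
Lemma mutateK t (k : 'I_n) : exchange_regular t -> mutate k (mutate k t) = t.
Proof.
move=> tx; have P0 := pos_ratio_neq0 (pos_ratio_exchange k tx).
have tk0 := pos_ratio_neq0 (tx.1 (lshift m k)).
(* Skew-symmetry kills the diagonal, so [x_k] does not occur in [P]. *)
have Bkk : smat t (lshift m k) k = 0.
  have /matrixP/(_ k k) := tx.2; rewrite !mxE => /eqP.
  by rewrite -addr_eq0 -mulr2n mulrn_eq0 => /eqP.
case: t tx P0 tk0 Bkk => y B /= tx; set P := (X in X != 0) => P0 tk0 Bkk.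
rewrite /mutate /= mutate_matK; congr Seed; apply/ffunP=> i.
rewrite !ffunE; case: eqP => [->|//].
have BN j : mutate_mat k B j k = - B j k by rewrite mxE eqxx orbT.
rewrite -/P; set y' := finfun _.
(* Column [k] has changed sign, so the two monomials of [P] trade places; by [Bkk] they avoid index
   [k], where alone [y'] differs from [y]. *)
rewrite [X in _ * X](_ : _ = P); last first.
  rewrite /P addrC; congr (_ + _); apply: eq_big => j; rewrite BN.
  - by rewrite oppr_lt0.
  - rewrite oppr_lt0 => Bj; rewrite opprK ffunE ifN //.
    by apply: contraTneq Bj => ->; rewrite Bkk ltxx.
  - by rewrite oppr_gt0.
  - rewrite oppr_gt0 => Bj; rewrite ffunE ifN //.
    by apply: contraTneq Bj => ->; rewrite Bkk ltxx.
exact: invf_mulVK P0.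
Qed.

End PosRatio.

Lemma is_seed_regular t : is_seed t -> exchange_regular (svar t) t.
Proof. by move=> [_ skew]; split=> // i; exact: pos_ratio_var. Qed.

Lemma reachable_regular t s :
  is_seed t -> reachable t s -> exchange_regular (svar t) s.
Proof.
move=> t_seed; elim=> [|k {}s _ s_reg]; first exact: is_seed_regular.
exact: (exchange_regular_mutate t_seed.1).
Qed.

Lemma reachable_trans t s u : reachable t s -> reachable s u -> reachable t u.
Proof. by move=> ts; elim=> // k {}u _; exact: reachable_mutate. Qed.

(** A path is reversed by repeating its mutations in the opposite order, each being its own inverse
    by [mutateK]. *)
Lemma reachable_sym t s : is_seed t -> reachable t s -> reachable s t.
Proof.
move=> t_seed; elim=> [|k {}s ts]; first exact: reachable_refl.
apply: reachable_trans; rewrite -[X in reachable _ X](mutateK t_seed.1 k).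
  exact/reachable_mutate/reachable_refl.
exact: reachable_regular.
Qed.

Lemma svar_neq0 t (s : seeds t) i : is_seed t -> svar s i != 0.
Proof.
move=> t_seed; have [sx _] := reachable_regular t_seed (seed_reachable s).
exact: pos_ratio_neq0 t_seed.1 _ (sx i).
Qed.

End MutationInvolution.

(** * Cluster tori and deep loci under a quasi-morphism *)

Section DeepLocus.
Local Open Scope ring_scope.
Variables (K : numFieldType) (n m : nat).

Section Frozen.
Variables (t : seed K n m) (s : seeds t).
Hypothesis t_seed : is_seed t.

Lemma svar_frozen j : svar s (rshift n j) = svar t (rshift n j).
Proof.
by case: s => u /=; elim=> // k {}u _ IH; rewrite ffunE ifN // eq_rlshift.
Qed.

Lemma frozen_monomial_in (e : 'I_m -> int) :
  in_cluster_algebra t (\prod_j svar s (rshift n j) ^ e j).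
Proof.
have t1 : in_cluster_algebra t 1.
  by rewrite -(rmorph1 (ratfun_scal K (n + m))); exact: ica_scal.
apply: big_ind => // [a b|j _]; first exact: ica_mul.
have tX a k : in_cluster_algebra t a -> in_cluster_algebra t (a ^+ k).
  by move=> ta; elim: k => // k IH; rewrite exprS; exact: ica_mul.
rewrite svar_frozen; case: (e j) => k; first exact/tX/ica_frozen.
by rewrite NegzE -exprz_inv; apply/tX/ica_frozenV.
Qed.

Definition frozen_monomial (e : 'I_m -> int) : cluster_algebra t :=
  Sub (\prod_j svar s (rshift n j) ^ e j) (asboolT (frozen_monomial_in e))
    : cluster_ring t.

Lemma frozen_monomialMN (e : 'I_m -> int) :
  frozen_monomial e * frozen_monomial (fun j => - e j) = 1.
Proof.
apply/val_inj; rewrite /= -big_split /= big1 // => j _.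
by rewrite -expfzDr ?subrr ?svar_neq0.
Qed.

Lemma prime_frozen (p : spec (cluster_algebra t)) j : ~ p (cvar s (rshift n j)).
Proof.
pose e i := if i == j then 1 else 0 : int.
suff -> : cvar s (rshift n j) = frozen_monomial e.
  exact: prime_ideal_unit (pt_prime p) (frozen_monomialMN e).
apply/val_inj; rewrite /= (bigD1 j) //= /e eqxx big1 ?mulr1 // => i ij.
by rewrite (negPf ij).
Qed.

Lemma cluster_torusP (p : spec (cluster_algebra t)) :
  cluster_torus s p <-> forall k, ~ p (cvar s (lshift m k)).
Proof.
split=> [sp k|sp i]; first exact: sp.
by case: (split_ordP i) => j ->; [exact: sp | exact: prime_frozen].
Qed.

End Frozen.

Variables (t1 t2 : seed K n m).
Hypotheses (seed_t1 : is_seed t1) (seed_t2 : is_seed t2).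
Variable f : quasi_morphism t2 t1.

Lemma qm_cvar_mutable (t : seeds t1) k : exists e,
  dual (qm_Psi f) (cvar t (lshift m k))
  = cvar (qm_Phi f t) (lshift m k) * frozen_monomial (qm_Phi f t) e.
Proof.
have [P [Q RE]] := qm_R_shape f t; exists (P^~ k); apply/val_inj.
rewrite (qm_svar f) big_split_ord /=; congr (_ * _); last first.
  by apply: eq_bigr => j _; rewrite RE block_mxEdl.
rewrite (bigD1 k) //= RE block_mxEul mxE eqxx big1 ?mulr1 // => l lk.
by rewrite block_mxEul mxE (negPf lk).
Qed.

Lemma qm_cluster_torus (t : seeds t1) p :
  cluster_torus t (spec_map (qm_Psi f) p) <-> cluster_torus (qm_Phi f t) p.
Proof.
rewrite !cluster_torusP //.
have tk k : spec_map (qm_Psi f) p (cvar t (lshift m k))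
    <-> p (cvar (qm_Phi f t) (lshift m k)).
  rewrite /=; have [e ->] := qm_cvar_mutable t k.
  exact: prime_idealMu (pt_prime p) (frozen_monomialMN _ seed_t2 e).
by split=> h k /tk; exact: h.
Qed.

(** Going back to [t2] and then on to [s] gives a mutation path from the image of the initial seed,
    which lifts step by step through [qm_Phi_mutate]. Comparing underlying seeds avoids comparing
    reachability proofs. *)
Lemma qm_Phi_surj (s : seeds t2) : exists t, seed_of (qm_Phi f t) = s.
Proof.
pose t0 : seeds t1 := SeedIn (reachable_refl t1).
have : reachable (qm_Phi f t0) s.
  apply: reachable_trans (seed_reachable s).
  exact/reachable_sym/seed_reachable.
elim=> [|k u _ [t tu]]; first by exists t0.
by exists (mutate_in k t); rewrite qm_Phi_mutate /= tu.
Qed.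

Lemma qm_deep_locus p :
  deep_locus t2 p <-> deep_locus t1 (spec_map (qm_Psi f) p).
Proof.
split=> Dp [t _ tp]; apply: Dp.
  by exists (qm_Phi f t) => //; apply/qm_cluster_torus.
have [u ut] := qm_Phi_surj t; exists u => //; apply/qm_cluster_torus => i.
suff -> : cvar (qm_Phi f u) i = cvar t i by exact: tp.
by apply/val_inj; rewrite /= ut.
Qed.

End DeepLocus.

Theorem corollary3p6 (R : realType) (n m : nat) (t1 t2 : seed R[i] n m)
    (seed_t1 : is_seed t1) (seed_t2 : is_seed t2)
    (f : quasi_morphism t2 t1) (iso_f : quasi_isomorphism f) :
  induces_iso (qm_Psi f) (deep_locus t2) (deep_locus t1).
Proof.
by apply: iso_induces_iso iso_f _ => p; exact: qm_deep_locus.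
Qed.
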